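(* Let $\mathsf{C}$ be a strictly positive Markov category. Let $p:\Theta\to X$ be a statistical model in $\mathsf{C}$ which has a minimal sufficient statistic. If $s:X\to V$ is a complete sufficient statistic for $p$ (that is, $s$ is a sufficient statistic for $p$ and $s\circ p$ is a complete morphism), then $s$ is minimal sufficient for $p$.
   Context: A Markov category is a symmetric monoidal category $(\mathsf{C},\otimes,I)$ with symmetry $\mathsf{swap}_{X,Y}:X\otimes Y\to Y\otimes X$, in which every object $X$ is equipped with morphisms $\mathsf{copy}_X:X\to X\otimes X$ and $\mathsf{del}_X:X\to I$ forming a commutative comonoid (coassociative, counital, cocommutative), such that: (i) $\mathsf{del}_{X\otimes Y}$ is $\mathsf{del}_X\otimes\mathsf{del}_Y$ followed by $I\otimes I\cong I$; (ii) $\mathsf{copy}_{X\otimes Y}$ is $\mathsf{copy}_X\otimes\mathsf{copy}_Y$ followed by the canonical isomorphism $(X\otimes X)\otimes(Y\otimes Y)\cong(X\otimes Y)\otimes(X\otimes Y)$ swapping the two middle factors; (iii) $\mathsf{del}_Y\circ f=\mathsf{del}_X$ for every $f:X\to Y$. Associators and unitors are suppressed in formulas. Deterministic: $f:X\to Y$ is deterministic if $\mathsf{copy}_Y\circ f=(f\otimes f)\circ\mathsf{copy}_X$. Almost sure equality: for $p:\Theta\to X$ and $f,g:X\to Y$, write $f=_{p\text{-a.s.}}g$ if $(\mathrm{id}_X\otimes f)\circ\mathsf{copy}_X\circ p=(\mathrm{id}_X\otimes g)\circ\mathsf{copy}_X\circ p$. Almost surely deterministic: for $p:\Theta\to X$,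 a morphism $f:X\to Y$ is $p$-a.s. deterministic if $\mathsf{copy}_Y\circ f=_{p\text{-a.s.}}(f\otimes f)\circ\mathsf{copy}_X$. Strictly positive: $\mathsf{C}$ is strictly positive if for all $p:\Theta\to X$, $f:X\to Y$, $g:Y\to Z$ such that $g\circ f$ is $p$-a.s. deterministic, one has $(g\otimes\mathrm{id}_Y)\circ\mathsf{copy}_Y\circ f=_{p\text{-a.s.}}\big((g\circ f)\otimes f\big)\circ\mathsf{copy}_X$. A statistical model with values in $X$ is any morphism $p:\Theta\to X$. A statistic for $p:\Theta\to X$ is a deterministic morphism $s:X\to V$. A statistic $s:X\to V$ is sufficient for $p$ if there is $\alpha:V\to X$ such that $(s\otimes\mathrm{id}_X)\circ\mathsf{copy}_X\circ p=(\mathrm{id}_V\otimes\alpha)\circ\mathsf{copy}_V\circ s\circ p$. A morphism $f:X\to Y$ is complete if for all objects $Z$ and all $g,h:Y\to Z$, $g\circ f=h\circ f$ implies $g=_{f\text{-a.s.}}h$. For statistics $s:X\to V$ and $t:X\to W$ for $p$, write $t\leq s$ if there is a morphism $c:V\to W$ in $\mathsf{C}$ such that $t=_{p\text{-a.s.}}c\circ s$. This is a preorder on the statistics for $p$. A statistic is minimal sufficient for $p$ if it is a least element of the preordered collection of sufficient statistics for $p$, i.e. it is sufficient and is $\leq r$ for every sufficient statistic $r$ for $p$. *)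

(* Defs.v *)
Set Implicit Arguments.
Unset Strict Implicit.
Unset Printing Implicit Defensive.

Declare Scope ob_scope.
Delimit Scope ob_scope with ob.
Declare Scope mor_scope.
Delimit Scope mor_scope with mor.

Record category : Type := Category {
  ob :> Type;
  hom : ob -> ob -> Type;
  idm : forall X, hom X X;
  comp : forall X Y Z, hom Y Z -> hom X Y -> hom X Z;
  comp_idl : forall X Y (f : hom X Y), comp (idm Y) f = f;
  comp_idr : forall X Y (f : hom X Y), comp f (idm X) = f;
  comp_assoc : forall X Y Z W (h : hom Z W) (g : hom Y Z) (f : hom X Y),
    comp h (comp g f) = comp (comp h g) f
}.

Bind Scope ob_scope with ob.
Bind Scope mor_scope with hom.
Arguments hom {c} X%_ob Y%_ob.
Arguments idm {c} X%_ob.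
Arguments comp {c} {X Y Z}%_ob (g f)%_mor.

Notation "g ∘ f" := (comp g f) (at level 40, left associativity) : mor_scope.

(* The operations of a symmetric monoidal category, without their laws. *)
Record tensor_category : Type := TensorCategory {
  tensor_cat :> category;
  unit_ob : tensor_cat;
  tensor : tensor_cat -> tensor_cat -> tensor_cat;
  tensor_mor : forall X Y X' Y' : tensor_cat,
    hom X X' -> hom Y Y' -> hom (tensor X Y) (tensor X' Y');
  assoc : forall X Y Z,
    hom (tensor (tensor X Y) Z) (tensor X (tensor Y Z));
  assoc_inv : forall X Y Z,
    hom (tensor X (tensor Y Z)) (tensor (tensor X Y) Z);
  lunit : forall X, hom (tensor unit_ob X) X;
  lunit_inv : forall X, hom X (tensor unit_ob X);
  runit : forall X, hom (tensor X unit_ob) X;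
  runit_inv : forall X, hom X (tensor X unit_ob);
  swap : forall X Y, hom (tensor X Y) (tensor Y X)
}.

Arguments unit_ob {t}.
Arguments tensor {t} (X Y)%_ob.
Arguments tensor_mor {t} {X Y X' Y'}%_ob (f g)%_mor.
Arguments assoc {t} (X Y Z)%_ob.
Arguments assoc_inv {t} (X Y Z)%_ob.
Arguments lunit {t} X%_ob.
Arguments lunit_inv {t} X%_ob.
Arguments runit {t} X%_ob.
Arguments runit_inv {t} X%_ob.
Arguments swap {t} (X Y)%_ob.

Notation "X ⊗ Y" := (tensor X Y) (at level 35, right associativity) : ob_scope.
Notation "f ⊗ g" := (tensor_mor f g)
  (at level 35, right associativity) : mor_scope.

Local Open Scope mor_scope.

Record is_symmetric_monoidal (C : tensor_category) : Prop := {
  tensor_id : forall X Y : C, idm X ⊗ idm Y = idm (X ⊗ Y);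
  tensor_comp : forall (X Y Z X' Y' Z' : C)
    (g : hom Y Z) (f : hom X Y) (g' : hom Y' Z') (f' : hom X' Y'),
    (g ∘ f) ⊗ (g' ∘ f') = (g ⊗ g') ∘ (f ⊗ f');

  assocK : forall X Y Z : C, assoc_inv X Y Z ∘ assoc X Y Z = idm _;
  assoc_invK : forall X Y Z : C, assoc X Y Z ∘ assoc_inv X Y Z = idm _;
  lunitK : forall X : C, lunit_inv X ∘ lunit X = idm _;
  lunit_invK : forall X : C, lunit X ∘ lunit_inv X = idm _;
  runitK : forall X : C, runit_inv X ∘ runit X = idm _;
  runit_invK : forall X : C, runit X ∘ runit_inv X = idm _;
  swapK : forall X Y : C, swap Y X ∘ swap X Y = idm _;

  assoc_nat : forall (X Y Z X' Y' Z' : C)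
    (f : hom X X') (g : hom Y Y') (h : hom Z Z'),
    assoc X' Y' Z' ∘ ((f ⊗ g) ⊗ h) = (f ⊗ (g ⊗ h)) ∘ assoc X Y Z;
  lunit_nat : forall (X Y : C) (f : hom X Y),
    lunit Y ∘ (idm unit_ob ⊗ f) = f ∘ lunit X;
  runit_nat : forall (X Y : C) (f : hom X Y),
    runit Y ∘ (f ⊗ idm unit_ob) = f ∘ runit X;
  swap_nat : forall (X Y X' Y' : C) (f : hom X X') (g : hom Y Y'),
    swap X' Y' ∘ (f ⊗ g) = (g ⊗ f) ∘ swap X Y;

  pentagon : forall X Y Z W : C,
    assoc X Y (Z ⊗ W) ∘ assoc (X ⊗ Y) Z W =
    (idm X ⊗ assoc Y Z W) ∘ assoc X (Y ⊗ Z) W ∘ (assoc X Y Z ⊗ idm W);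
  triangle : forall X Y : C,
    (idm X ⊗ lunit Y) ∘ assoc X unit_ob Y = runit X ⊗ idm Y;
  hexagon : forall X Y Z : C,
    assoc Y Z X ∘ swap X (Y ⊗ Z) ∘ assoc X Y Z =
    (idm Y ⊗ swap X Z) ∘ assoc Y X Z ∘ (swap X Y ⊗ idm Z)
}.

Definition swap_middle (C : tensor_category) (X Y Z W : C) :
    hom ((X ⊗ Y) ⊗ (Z ⊗ W)) ((X ⊗ Z) ⊗ (Y ⊗ W)) :=
  assoc_inv X Z (Y ⊗ W)
  ∘ (idm X ⊗ (assoc Z Y W ∘ (swap Y Z ⊗ idm W) ∘ assoc_inv Y Z W))
  ∘ assoc X Y (Z ⊗ W).

Record copy_del_category : Type := CopyDelCategory {
  copy_del_cat :> tensor_category;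
  copy : forall X : copy_del_cat, hom X (X ⊗ X);
  del : forall X : copy_del_cat, hom X unit_ob
}.

Arguments copy {c} X%_ob.
Arguments del {c} X%_ob.

Record is_markov (C : copy_del_category) : Prop := {
  copy_assoc : forall X : C,
    assoc X X X ∘ (copy X ⊗ idm X) ∘ copy X = (idm X ⊗ copy X) ∘ copy X;
  copy_counitl : forall X : C, lunit X ∘ (del X ⊗ idm X) ∘ copy X = idm X;
  copy_counitr : forall X : C, runit X ∘ (idm X ⊗ del X) ∘ copy X = idm X;
  copy_comm : forall X : C, swap X X ∘ copy X = copy X;

  del_tensor : forall X Y : C, del (X ⊗ Y) = lunit unit_ob ∘ (del X ⊗ del Y);
  copy_tensor : forall X Y : C,
    copy (X ⊗ Y) = swap_middle X X Y Y ∘ (copy X ⊗ copy Y);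
  del_nat : forall (X Y : C) (f : hom X Y), del Y ∘ f = del X
}.

Record markov_category : Type := MarkovCategory {
  markov_cat :> copy_del_category;
  markov_symmetric_monoidal : is_symmetric_monoidal markov_cat;
  markov_axioms : is_markov markov_cat
}.

Definition deterministic (C : markov_category) (X Y : C) (f : hom X Y) : Prop :=
  copy Y ∘ f = (f ⊗ f) ∘ copy X.

Definition as_eq (C : markov_category) (Θ X Y : C) (p : hom Θ X)
    (f g : hom X Y) : Prop :=
  (idm X ⊗ f) ∘ copy X ∘ p = (idm X ⊗ g) ∘ copy X ∘ p.

Notation "f =[ p ] g" := (as_eq p f g)
  (at level 70, p at level 60, format "f  =[ p ]  g") : mor_scope.

Definition as_deterministic (C : markov_category) (Θ X Y : C) (p : hom Θ X)
    (f : hom X Y) : Prop :=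
  copy Y ∘ f =[p] (f ⊗ f) ∘ copy X.

Definition strictly_positive (C : markov_category) : Prop :=
  forall (Θ X Y Z : C) (p : hom Θ X) (f : hom X Y) (g : hom Y Z),
    as_deterministic p (g ∘ f) ->
    (g ⊗ idm Y) ∘ copy Y ∘ f =[p] ((g ∘ f) ⊗ f) ∘ copy X.

(* Being a statistic for [p] depends only on the source [X] of [s]. *)
Definition statistic (C : markov_category) (Θ X V : C) (p : hom Θ X)
    (s : hom X V) : Prop :=
  deterministic s.

Definition sufficient_statistic (C : markov_category) (Θ X V : C)
    (p : hom Θ X) (s : hom X V) : Prop :=
  statistic p s /\
  exists α : hom V X,
    (s ⊗ idm X) ∘ copy X ∘ p = (idm V ⊗ α) ∘ copy V ∘ s ∘ p.

Definition complete (C : markov_category) (X Y : C) (f : hom X Y) : Prop :=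
  forall (Z : C) (g h : hom Y Z), g ∘ f = h ∘ f -> g =[f] h.

(* [statistic_le p t s] is t ≤ s; the comparison morphism [c] is an arbitrary
   morphism, not required to be deterministic. *)
Definition statistic_le (C : markov_category) (Θ X V W : C) (p : hom Θ X)
    (t : hom X W) (s : hom X V) : Prop :=
  exists c : hom V W, t =[p] c ∘ s.

Definition minimal_sufficient_statistic (C : markov_category) (Θ X V : C)
    (p : hom Θ X) (s : hom X V) : Prop :=
  sufficient_statistic p s /\
  forall (W : C) (r : hom X W),
    sufficient_statistic p r -> statistic_le p s r.

(* Main.v *)
(** Let [t] be minimal sufficient, with [t] = [c ∘ s] [p]-a.s., and let [β] recover
    [p] from [t], so that [β ∘ t ∘ p = p].  Then [s ∘ β ∘ c] fixes [s ∘ p], and by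
    completeness it is [s ∘ p]-a.s. the identity.  As [s] is sufficient, the joint
    distribution of [X] and [V] is obtained from [copy V ∘ s ∘ p] by applying [α] to
    one factor, so this equality pulls back along [s] to one that holds [p]-a.s.:
    [s] = [s ∘ β ∘ c ∘ s] = [s ∘ β ∘ t].  Hence [s ≤ t], and [t] is least. *)

Require Import Defs.
Local Open Scope mor_scope.

Section AlmostSure.

Variable C : markov_category.

Let smc := markov_symmetric_monoidal C.
Let mkv := markov_axioms C.

Lemma tensor_idl_comp (A X Y Z : C) (g : hom Y Z) (f : hom X Y) :
  idm A ⊗ (g ∘ f) = (idm A ⊗ g) ∘ (idm A ⊗ f).
Proof. rewrite <- (tensor_comp smc), comp_idl; reflexivity. Qed.

Lemma tensor_interchange (X Y X' Y' : C) (f : hom X Y) (g : hom X' Y') :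
  (f ⊗ idm Y') ∘ (idm X ⊗ g) = (idm Y ⊗ g) ∘ (f ⊗ idm X').
Proof. rewrite <- !(tensor_comp smc), !comp_idl, !comp_idr; reflexivity. Qed.

(** [f] slides past the deletion of the other factor, and the counit law does the rest. This is how
    equations between joint distributions are reduced to their marginals. *)
Lemma copy_marginalr (X Y : C) (f : hom X Y) :
  lunit Y ∘ (del X ⊗ idm Y) ∘ ((idm X ⊗ f) ∘ copy X) = f.
Proof.
rewrite comp_assoc, <- (comp_assoc (lunit Y)), tensor_interchange.
rewrite comp_assoc, (lunit_nat smc), <- !comp_assoc.
rewrite (comp_assoc (lunit X)), (copy_counitl mkv), comp_idr; reflexivity.
Qed.

Lemma as_eq_comp_eq (Θ X Y : C) (p : hom Θ X) (f g : hom X Y) :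
  f =[p] g -> f ∘ p = g ∘ p.
Proof.
intro fg.
rewrite <- (copy_marginalr X Y f), <- (copy_marginalr X Y g), <- !comp_assoc.
rewrite !(comp_assoc _ (copy X) p), fg; reflexivity.
Qed.

Lemma as_eq_postcomp (Θ X Y Z : C) (p : hom Θ X) (f g : hom X Y) (h : hom Y Z) :
  f =[p] g -> h ∘ f =[p] h ∘ g.
Proof.
unfold as_eq; intro fg.
rewrite !tensor_idl_comp, <- !comp_assoc.
rewrite !(comp_assoc _ (copy X) p), fg; reflexivity.
Qed.

(** Delete the factor [V] on both sides: on the left, naturality of [del] absorbs [s]. *)
Lemma sufficient_recovers (Θ X V : C) (p : hom Θ X) (s : hom X V) (α : hom V X) :
  (s ⊗ idm X) ∘ copy X ∘ p = (idm V ⊗ α) ∘ copy V ∘ s ∘ p ->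
  α ∘ s ∘ p = p.
Proof.
intro suff.
apply (f_equal (comp (lunit X ∘ (del V ⊗ idm X)))) in suff.
rewrite <- (comp_assoc _ s p), (comp_assoc _ _ (s ∘ p)), copy_marginalr in suff.
rewrite <- comp_assoc, <- suff, <- !comp_assoc, (comp_assoc (del V ⊗ idm X)).
rewrite <- (tensor_comp smc), (del_nat mkv), comp_idl.
rewrite !comp_assoc, (copy_counitl mkv), comp_idl; reflexivity.
Qed.

(** Swap both sides; cocommutativity absorbs the swap into each [copy]. *)
Lemma sufficient_joint (Θ X V : C) (p : hom Θ X) (s : hom X V) (α : hom V X) :
  (s ⊗ idm X) ∘ copy X ∘ p = (idm V ⊗ α) ∘ copy V ∘ s ∘ p ->
  (idm X ⊗ s) ∘ copy X ∘ p = (α ⊗ idm V) ∘ (copy V ∘ (s ∘ p)).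
Proof.
intro suff.
apply (f_equal (comp (swap V X))) in suff.
rewrite !comp_assoc, !(swap_nat smc) in suff.
rewrite <- (comp_assoc _ (swap X X)), (copy_comm mkv) in suff.
rewrite <- (comp_assoc _ (swap V V)), (copy_comm mkv) in suff.
rewrite suff, <- !comp_assoc; reflexivity.
Qed.

Lemma sufficient_as_eq_precomp (Θ X V Z : C) (p : hom Θ X) (s : hom X V)
    (f g : hom V Z) :
  sufficient_statistic p s -> f =[s ∘ p] g -> f ∘ s =[p] g ∘ s.
Proof.
unfold as_eq; intros [_ [α suff]] fg.
apply sufficient_joint in suff.
rewrite !tensor_idl_comp, <- !comp_assoc.
(* [α] acts on the factor that [f] and [g] leave alone, so it can be moved outermost, exposing both
   sides of [fg]. *)
rewrite !(comp_assoc _ (copy X) p), suff, !comp_assoc, <- !tensor_interchange.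
rewrite <- !comp_assoc in *; rewrite fg; reflexivity.
Qed.

End AlmostSure.

Theorem theorem16p3 (C : markov_category) (C_strictly_positive : strictly_positive C)
    (Θ X : C) (p : hom Θ X)
    (p_has_minimal : exists (W : C) (t : hom X W), minimal_sufficient_statistic p t)
    (V : C) (s : hom X V)
    (s_sufficient : sufficient_statistic p s)
    (s_complete : complete (s ∘ p)) :
  minimal_sufficient_statistic p s.
Proof.
destruct p_has_minimal as (W & t & (_ & β & t_suff) & t_least).
apply sufficient_recovers in t_suff.
destruct (t_least V s s_sufficient) as [c tc].
assert (fixed : s ∘ β ∘ c ∘ (s ∘ p) = idm V ∘ (s ∘ p)).
{ pose proof (as_eq_comp_eq C _ _ _ _ _ _ tc) as tcp.
  rewrite comp_idl, <- !comp_assoc, (comp_assoc c s p), <- tcp.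
  rewrite (comp_assoc β t p), t_suff; reflexivity. }
apply s_complete, (sufficient_as_eq_precomp C) in fixed; [|exact s_sufficient].
rewrite comp_idl, <- comp_assoc in fixed.
split; [exact s_sufficient|]; intros U r r_suff.
destruct (t_least U r r_suff) as [d td].
(* Almost surely, [s] equals [s ∘ β ∘ t], and [t] equals [d ∘ r]. *)
exists (s ∘ β ∘ d).
apply (as_eq_postcomp C _ _ _ _ _ _ _ (s ∘ β)) in tc, td.
rewrite comp_assoc in td.
unfold as_eq in *; congruence.
Qed.
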